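(* Let $(N,T)$ be a Nijenhuis pair on a ternary Leibniz algebra $(L,[-,-,-])$ with a representation $(V,\lambda,\mu,\rho)$. Then a deformation of $(L,[-,-,-],\lambda,\mu,\rho)$ is obtained by putting, for all $x,y,z\in L$, $$\omega^1(x,y,z)=[N(x),y,z]+[x,N(y),z]+[x,y,N(z)],$$ $$\omega^2(x,y,z)=[N(x),N(y),z]+[N(x),y,N(z)]+[x,N(y),N(z)]-N\big([N(x),y,z]+[x,N(y),z]+[x,y,N(z)]\big),$$ $$\omega_\lambda^1(x,y)=\lambda(x,y)T+\lambda(N(x),y)+\lambda(x,N(y))-T\lambda(x,y),$$ $$\omega_\lambda^2(x,y)=\lambda(N(x),N(y))+\lambda(N(x),y)T+\lambda(x,N(y))T-T\omega_\lambda^1(x,y),$$ $$\omega_\mu^1(x,y)=\mu(x,y)T+\mu(N(x),y)+\mu(x,N(y))-T\mu(x,y),$$ $$\omega_\mu^2(x,y)=\mu(N(x),N(y))+\mu(N(x),y)T+\mu(x,N(y))T-T\omega_\mu^1(x,y),$$ $$\omega_\rho^1(x,y)=\rho(x,y)T+\rho(N(x),y)+\rho(x,N(y))-T\rho(x,y),$$ $$\omega_\rho^2(x,y)=\rho(N(x),N(y))+\rho(N(x),y)T+\rho(x,N(y))T-T\omega_\rho^1(x,y).$$ Furthermore, this deformation is trivial.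
   Context: Vector spaces are over a field $\mathbb{K}$. A ternary Leibniz algebra is a vector space $L$ with a trilinear map $[-,-,-]$ such that $[[x,y,z],t,u]=[x,y,[z,t,u]]+[x,[y,t,u],z]+[[x,t,u],y,z]$ for all $x,y,z,t,u\in L$. A representation $(V,\lambda,\mu,\rho)$ of $L$ on a vector space $V$ consists of three bilinear maps $\lambda,\mu,\rho:L\times L\to \mathrm{End}(V)$ such that for all $x,y,z,t\in L$: $$\lambda([x,y,z],t)=\lambda(x,y)\lambda(z,t)+\mu(x,z)\lambda(y,t)+\rho(y,z)\lambda(x,t),$$ $$\mu([x,y,z],t)=\lambda(x,y)\mu(z,t)+\mu(x,z)\mu(y,t)+\rho(y,z)\mu(x,t),$$ $$\rho(z,t)\lambda(x,y)=\lambda(x,y)\rho(z,t)+\lambda(x,[y,z,t])+\lambda([x,z,t],y),$$ $$\rho(z,t)\mu(x,y)=\mu(x,[y,z,t])+\mu(x,y)\rho(z,t)+\mu([x,z,t],y),$$ $$\rho(z,t)\rho(x,y)=\rho(x,[y,z,t])+\rho([x,z,t],y)+\rho(x,y)\rho(z,t).$$ A linear map $N:L\to L$ is a Nijenhuis operator if for all $x,y,z\in L$ $$[N(x),N(y),N(z)]=N\big([N(x),N(y),z]+[N(x),y,N(z)]+[x,N(y),N(z)]\big)-N^2\big([N(x),y,z]+[x,N(y),z]+[x,y,N(z)]\big)+N^3([x,y,z]).$$ A Nijenhuis pair on $L$ with representation $(V,\lambda,\mu,\rho)$ is a pair $(N,T)$ with $N\in\mathrm{End}(L)$ a Nijenhuis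 operator and $T\in\mathrm{End}(V)$ such that for each $\theta\in\{\lambda,\mu,\rho\}$ and all $x,y\in L$ $$\theta(N(x),N(y))T=T\big(\theta(N(x),N(y))+\theta(N(x),y)T+\theta(x,N(y))T\big)-T^2\big(\theta(x,y)T+\theta(N(x),y)+\theta(x,N(y))\big)+T^3\theta(x,y).$$ Deformation: let $\omega^i:L\times L\times L\to L$ be trilinear and $\omega^i_\lambda,\omega^i_\mu,\omega^i_\rho:L\times L\to\mathrm{End}(V)$ bilinear ($i=1,2$). Consider the $s$-parametrized families $[x,y,z]_s=[x,y,z]+s\,\omega^1(x,y,z)+s^2\omega^2(x,y,z)$ and $\theta_s(x,y)=\theta(x,y)+s\,\omega_\theta^1(x,y)+s^2\omega_\theta^2(x,y)$ for $\theta\in\{\lambda,\mu,\rho\}$. If the $(L,[-,-,-]_s)$ are ternary Leibniz algebras and the $(\lambda_s,\mu_s,\rho_s)$ are representations of $(L,[-,-,-]_s)$ on $V$, these data generate a one-parameter infinitesimal deformation $(L,[-,-,-]_s,\lambda_s,\mu_s,\rho_s)$ of $L$ with the representation $(V,\lambda,\mu,\rho)$. Two such deformations $(L,[-,-,-]_s,\lambda_s,\mu_s,\rho_s)$ and $(L,[-,-,-]'_s,\lambda'_s,\mu'_s,\rho'_s)$ are equivalent if there exists an isomorphism $(\mathrm{Id}_L+sN',\mathrm{Id}_V+sT')$, with $N'\in\mathrm{End}(L)$ and $T'\in\mathrm{End}(V)$, from the first to the second, i.e. for all $x,y,z\in L$ and each $\theta\in\{\lambda,\mu,\rho\}$, $$(\mathrm{Id}_L+sN')[x,y,z]'_s=[(\mathrm{Id}_L+sN')(x),(\mathrm{Id}_L+sN')(y),(\mathrm{Id}_L+sN')(z)]_s,$$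 $$(\mathrm{Id}_V+sT')\theta'_s(x,y)=\theta_s\big((\mathrm{Id}_L+sN')(x),(\mathrm{Id}_L+sN')(y)\big)\circ(\mathrm{Id}_V+sT').$$ A deformation is trivial if it is equivalent to $(L,[-,-,-],\lambda,\mu,\rho)$.
   Formalization: The printed ω¹ lacks the term −N[x,y,z], making the claim false (e.g. N=Id, T=Id); here ω¹ includes it and ω² uses −Nω¹, adding N²[x,y,z]. Triviality means Id+sN', Id+sT' map the deformed structure to the original, as the other order fails. *)

(* Defs.v *)
From HB Require Import structures.
From mathcomp Require Import all_boot all_algebra.

Set Implicit Arguments.
Unset Strict Implicit.
Unset Printing Implicit Defensive.

Import GRing.Theory.
Local Open Scope ring_scope.

Section TernaryLeibniz.
Variable K : fieldType.

Definition trilinear (U1 U2 U3 W : lmodType K) (f : U1 -> U2 -> U3 -> W) : Prop :=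
  [/\ forall y z, linear (fun x => f x y z),
      forall x z, linear (fun y => f x y z)
    & forall x y, linear (fun z => f x y z)].

Variables L V : lmodType K.

(* A bilinear map theta : L x L -> End(V) is given in curried form
   L -> L -> V -> V; being bilinear with values in End(V) is then [trilinear],
   and equalities in End(V) are stated pointwise. *)
Record operations := Operations {
  bracket : L -> L -> L -> L;
  lam : L -> L -> V -> V;
  mu : L -> L -> V -> V;
  rho : L -> L -> V -> V
}.

Definition multilinear_operations (A : operations) : Prop :=
  [/\ trilinear (bracket A), trilinear (lam A), trilinear (mu A)
    & trilinear (rho A)].

Definition ternary_leibniz (br : L -> L -> L -> L) : Prop :=
  trilinear br /\
  forall x y z t u,
    br (br x y z) t u
    = br x y (br z t u) + br x (br y t u) z + br (br x t u) y z.

Definition representation (A : operations) : Prop :=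
  let br := bracket A in let l := lam A in let m := mu A in let r := rho A in
  [/\ trilinear l, trilinear m & trilinear r] /\
  forall (x y z t : L) (v : V),
    [/\ l (br x y z) t v
          = l x y (l z t v) + m x z (l y t v) + r y z (l x t v),
        m (br x y z) t v
          = l x y (m z t v) + m x z (m y t v) + r y z (m x t v),
        r z t (l x y v)
          = l x y (r z t v) + l x (br y z t) v + l (br x z t) y v,
        r z t (m x y v)
          = m x (br y z t) v + m x y (r z t v) + m (br x z t) y v
      & r z t (r x y v)
          = r x (br y z t) v + r (br x z t) y v + r x y (r z t v)].

Definition nijenhuis_operator (br : L -> L -> L -> L) (N : {linear L -> L}) : Prop :=
  forall x y z,
    br (N x) (N y) (N z)
    = N (br (N x) (N y) z + br (N x) y (N z) + br x (N y) (N z))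
      - N (N (br (N x) y z + br x (N y) z + br x y (N z)))
      + N (N (N (br x y z))).

Definition nijenhuis_compatible (N : {linear L -> L}) (T : {linear V -> V})
    (theta : L -> L -> V -> V) : Prop :=
  forall x y v,
    theta (N x) (N y) (T v)
    = T (theta (N x) (N y) v + theta (N x) y (T v) + theta x (N y) (T v))
      - T (T (theta x y (T v) + theta (N x) y v + theta x (N y) v))
      + T (T (T (theta x y v))).

Definition nijenhuis_pair (A : operations)
    (N : {linear L -> L}) (T : {linear V -> V}) : Prop :=
  nijenhuis_operator (bracket A) N /\
  [/\ nijenhuis_compatible N T (lam A), nijenhuis_compatible N T (mu A)
    & nijenhuis_compatible N T (rho A)].

Definition deformed (A W1 W2 : operations) (s : K) : operations :=
  let def3 (U : lmodType K) (X Y Z : Type) (f f1 f2 : X -> Y -> Z -> U) x y z :=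
    f x y z + s *: f1 x y z + s ^+ 2 *: f2 x y z in
  {| bracket := def3 _ _ _ _ (bracket A) (bracket W1) (bracket W2);
     lam := def3 _ _ _ _ (lam A) (lam W1) (lam W2);
     mu := def3 _ _ _ _ (mu A) (mu W1) (mu W2);
     rho := def3 _ _ _ _ (rho A) (rho W1) (rho W2) |}.

Definition infinitesimal_deformation (A W1 W2 : operations) : Prop :=
  [/\ multilinear_operations W1, multilinear_operations W2
    & forall s : K, ternary_leibniz (bracket (deformed A W1 W2 s))
                    /\ representation (deformed A W1 W2 s)].

(* [B] and [B'] are families of operations indexed by the parameter s; N' and
   T' do not depend on s. Invertibility of Id + sN' and Id + sT' is automatic
   for formal s but not at each s in K, so only the intertwining identities
   are required. *)
Definition equivalent_families (B B' : K -> operations) : Prop :=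
  exists (N' : {linear L -> L}) (T' : {linear V -> V}), forall s : K,
    let phi (x : L) := x + s *: N' x in
    let psi (v : V) := v + s *: T' v in
    let intertwines (theta theta' : L -> L -> V -> V) :=
      forall x y v, psi (theta' x y v) = theta (phi x) (phi y) (psi v) in
    [/\ forall x y z, phi (bracket (B' s) x y z)
                      = bracket (B s) (phi x) (phi y) (phi z),
        intertwines (lam (B s)) (lam (B' s)),
        intertwines (mu (B s)) (mu (B' s))
      & intertwines (rho (B s)) (rho (B' s))].

(* [equivalent_families] is not syntactically symmetric: the constant family
   is its first argument, so that Id + sN' and Id + sT' map the deformed
   structure to the original one. *)
Definition trivial_deformation (A W1 W2 : operations) : Prop :=
  equivalent_families (fun=> A) (deformed A W1 W2).

Definition theta_omega1 (N : {linear L -> L}) (T : {linear V -> V})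
    (theta : L -> L -> V -> V) (x y : L) (v : V) : V :=
  theta x y (T v) + theta (N x) y v + theta x (N y) v - T (theta x y v).

Definition theta_omega2 (N : {linear L -> L}) (T : {linear V -> V})
    (theta : L -> L -> V -> V) (x y : L) (v : V) : V :=
  theta (N x) (N y) v + theta (N x) y (T v) + theta x (N y) (T v)
  - T (theta_omega1 N T theta x y v).

(* The summand - N [x,y,z] (absent from the printed source formula) is what
   makes Id + sN intertwine the brackets at order s, exactly as - T (theta x y)
   does in [theta_omega1]. Without it the deformed maps are not representations
   in general: for N = Id, T = Id one would get the bracket (1 + 3s)[x,y,z]
   with theta_s = (1 + s)^2 theta. *)
Definition bracket_omega1 (N : {linear L -> L}) (br : L -> L -> L -> L)
    (x y z : L) : L :=
  br (N x) y z + br x (N y) z + br x y (N z) - N (br x y z).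

Definition bracket_omega2 (N : {linear L -> L}) (br : L -> L -> L -> L)
    (x y z : L) : L :=
  br (N x) (N y) z + br (N x) y (N z) + br x (N y) (N z)
  - N (bracket_omega1 N br x y z).

Definition nijenhuis_omega1 (A : operations)
    (N : {linear L -> L}) (T : {linear V -> V}) : operations :=
  {| bracket := bracket_omega1 N (bracket A);
     lam := theta_omega1 N T (lam A);
     mu := theta_omega1 N T (mu A);
     rho := theta_omega1 N T (rho A) |}.

Definition nijenhuis_omega2 (A : operations)
    (N : {linear L -> L}) (T : {linear V -> V}) : operations :=
  {| bracket := bracket_omega2 N (bracket A);
     lam := theta_omega2 N T (lam A);
     mu := theta_omega2 N T (mu A);
     rho := theta_omega2 N T (rho A) |}.

End TernaryLeibniz.

(* Main.v *)
Require Import Defs.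
From HB Require Import structures.
From mathcomp Require Import all_boot all_algebra.
From mathcomp Require Import ring.

(** The cochains [omega1] and [omega2] are made so that [Id + s N] and
    [Id + s T] carry the deformed operations to the original ones. Comparing
    powers of [s], orders 1 and 2 of this intertwining define [omega1] and
    [omega2], and order 3 is the Nijenhuis condition ([twist_theta],
    [twist_omega1], [twist_omega2]). This is triviality of the deformation
    ([intertwine_omega]).

    It remains to see that the deformed operations satisfy the Leibniz and
    representation axioms. Transporting them back along [Id + s N] fails when
    this map is not invertible, which may happen for every nonzero [s] in [K].
    But [Id + s N] is injective on polynomials in a formal [s]: if [D] is the
    deformed Leibniz defect, a polynomial of degree at most 4 in [s], then
    [(Id + s N) D] is the original defect at the arguments [x + s N x], hence
    zero, and the coefficients of [D] vanish one after the other
    ([defect1] to [defect4], assembled in [leibniz_pencil]).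

    To do this only once, everything is moved to [L * V]. The
    semidirect product bracket is ternary Leibniz exactly when [L] is one and
    [V] is a representation ([leibniz_semidirect], [leibniz_of_semidirect]),
    and both the Nijenhuis condition and the deformation of [(L, V)] by
    [(N, T)] are those of [L * V] by the one operator [pair_map N T]
    ([semidirect_nijenhuis], [semidirect_omega1], [semidirect_omega2]). *)

Set Implicit Arguments.
Unset Strict Implicit.
Unset Printing Implicit Defensive.

Import GRing.Theory.
Local Open Scope ring_scope.

(** * Deciding linear identities in a module *)

Section SquareZero.
Variables (K : fieldType) (M : lmodType K).

(** The trivial square-zero extension of [K] by [M]: scalars and vectors sit in
    one commutative ring, [M * M = 0], and scaling a vector becomes a ring
    product. So an identity between linear combinations of vectors is a
    polynomial identity in this ring, which [ring] decides. *)
Definition sqzero : Type := (K * M)%type.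
HB.instance Definition _ := GRing.Zmodule.on sqzero.

Definition sqzero_one : sqzero := (1, 0).
Definition sqzero_mul (p q : sqzero) : sqzero :=
  (p.1 * q.1, p.1 *: q.2 + q.1 *: p.2).

Fact sqzero_mulA : associative sqzero_mul.
Proof.
move=> [a x] [b y] [c z]; congr (_, _) => /=; first by rewrite mulrA.
by rewrite !scalerDr !scalerA addrA [c * a]mulrC [c * b]mulrC.
Qed.

Fact sqzero_mulC : commutative sqzero_mul.
Proof. by move=> [a x] [b y]; congr (_, _); rewrite /= (mulrC, addrC). Qed.

Fact sqzero_mul1 : left_id sqzero_one sqzero_mul.
Proof. by move=> [a x]; rewrite /sqzero_mul /= mul1r scale1r scaler0 addr0. Qed.

Fact sqzero_mulDl : left_distributive sqzero_mul +%R.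
Proof.
move=> [a x] [b y] [c z]; congr (_, _) => /=; first by rewrite mulrDl.
by rewrite scalerDl scalerDr addrACA.
Qed.

Fact sqzero_one_neq0 : sqzero_one != 0.
Proof. by apply/eqP => -[/eqP]; rewrite oner_eq0. Qed.

HB.instance Definition _ := GRing.Zmodule_isComNzRing.Build sqzero
  sqzero_mulA sqzero_mulC sqzero_mul1 sqzero_mulDl sqzero_one_neq0.

Definition sqzero_vec (x : M) : sqzero := (0, x).
Definition sqzero_scal (a : K) : sqzero := (a, 0).

Fact sqzero_vec_additive : zmod_morphism sqzero_vec.
Proof. by move=> x y; congr (_, _); rewrite /= subr0. Qed.
HB.instance Definition _ :=
  GRing.isZmodMorphism.Build M sqzero sqzero_vec sqzero_vec_additive.

Fact sqzero_scal_additive : zmod_morphism sqzero_scal.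
Proof. by move=> x y; congr (_, _); rewrite /= subr0. Qed.
HB.instance Definition _ :=
  GRing.isZmodMorphism.Build K sqzero sqzero_scal sqzero_scal_additive.

Fact sqzero_scal_multiplicative : monoid_morphism sqzero_scal.
Proof. by split=> // x y; congr (_, _); rewrite /= !scaler0 addr0. Qed.
HB.instance Definition _ :=
  GRing.isMonoidMorphism.Build K sqzero sqzero_scal sqzero_scal_multiplicative.

Lemma sqzero_vecZ a x : sqzero_vec (a *: x) = sqzero_scal a * sqzero_vec x.
Proof. by congr (_, _); rewrite /= ?mulr0 ?scale0r ?addr0. Qed.

Lemma sqzero_vecD x y : sqzero_vec (x + y) = sqzero_vec x + sqzero_vec y.
Proof. exact: raddfD. Qed.

Lemma sqzero_vecN x : sqzero_vec (- x) = - sqzero_vec x.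
Proof. exact: raddfN. Qed.

Lemma sqzero_vec0 : sqzero_vec 0 = 0.
Proof. by []. Qed.

Lemma sqzero_vec_inj : injective sqzero_vec.
Proof. by move=> x y []. Qed.

End SquareZero.

Ltac lmod_ring :=
  apply: sqzero_vec_inj; rewrite ?sqzero_vec0;
  do ?[rewrite !(sqzero_vecD, sqzero_vecN, sqzero_vecZ)];
  ring.

(** * Trilinear maps *)

(** Rewriting with all the rules at once expands nested linear and trilinear
    maps in any order. *)
Lemma linear_rules (K : fieldType) (U W : lmodType K) (g : U -> W) :
  linear g ->
  (((forall x x', (g (x + x') = g x + g x')%R) *
    (forall x, (g (- x) = - g x)%R)) *
   ((forall a x, (g (a *: x) = a *: g x)%R) * (g 0 = 0)%R))%type.
Proof.
move=> lin; have D x x' : g (x + x') = g x + g x'.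
  by have := lin 1 x x'; rewrite !scale1r.
have g0 : g 0 = 0 by apply: (addrI (g 0)); rewrite -D !addr0.
have Z a x : g (a *: x) = a *: g x by rewrite -[a *: x]addr0 lin g0 addr0.
by do ![split=> //] => x; rewrite -scaleN1r Z scaleN1r.
Qed.

Lemma trilinear_rules (K : fieldType) (U1 U2 U3 W : lmodType K)
    (f : U1 -> U2 -> U3 -> W) :
  trilinear f ->
  (((forall x x' y z, (f (x + x') y z = f x y z + f x' y z)%R) *
    (forall x y z, (f (- x) y z = - f x y z)%R) *
    (forall a x y z, (f (a *: x) y z = a *: f x y z)%R) *
    (forall y z, (f 0 y z = 0)%R)) *
   ((forall x y y' z, (f x (y + y') z = f x y z + f x y' z)%R) *
    (forall x y z, (f x (- y) z = - f x y z)%R) *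
    (forall a x y z, (f x (a *: y) z = a *: f x y z)%R) *
    (forall x z, (f x 0 z = 0)%R)) *
   ((forall x y z z', (f x y (z + z') = f x y z + f x y z')%R) *
    (forall x y z, (f x y (- z) = - f x y z)%R) *
    (forall a x y z, (f x y (a *: z) = a *: f x y z)%R) *
    (forall x y, (f x y 0 = 0)%R)))%type.
Proof.
case=> lin1 lin2 lin3.
have R1 y z := linear_rules (lin1 y z).
have R2 x z := linear_rules (lin2 x z).
have R3 x y := linear_rules (lin3 x y).
split; [split|]; do 3?[split].
all: move=> *; by [rewrite R1 | rewrite R2 | rewrite R3].
Qed.

Lemma trilinear_pencil (K : fieldType) (U1 U2 U3 W : lmodType K)
    (f f1 f2 : U1 -> U2 -> U3 -> W) (s : K) :
  trilinear f -> trilinear f1 -> trilinear f2 ->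
  trilinear (fun x y z => f x y z + s *: f1 x y z + s ^+ 2 *: f2 x y z).
Proof.
move=> /trilinear_rules r /trilinear_rules r1 /trilinear_rules r2.
by split=> ? ? a ? ?; rewrite !(r, r1, r2); lmod_ring.
Qed.

Lemma eq_trilinear (K : fieldType) (U1 U2 U3 W : lmodType K)
    (f g : U1 -> U2 -> U3 -> W) :
  (forall x y z, f x y z = g x y z) -> trilinear f -> trilinear g.
Proof.
by move=> e [lin1 lin2 lin3]; split=> ? ? a u v;
  rewrite -!e (lin1, lin2, lin3).
Qed.

(** * The cochains of a Nijenhuis pair *)

Section Omega.
Variables (K : fieldType) (L V : lmodType K).
Variables (N : {linear L -> L}) (T : {linear V -> V}) (theta : L -> L -> V -> V).
Hypothesis tri : trilinear theta.
Let rules :=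
  (trilinear_rules tri, linear_rules (linearP N), linear_rules (linearP T)).

Lemma trilinear_theta_omega1 : trilinear (theta_omega1 N T theta).
Proof.
split=> ? ? a ? ?; rewrite /theta_omega1 !rules; lmod_ring.
Qed.

Lemma trilinear_theta_omega2 : trilinear (theta_omega2 N T theta).
Proof.
have rules1 := trilinear_rules trilinear_theta_omega1.
split=> ? ? a ? ?; rewrite /theta_omega2 !(rules, rules1); lmod_ring.
Qed.

(** Read as power series in a formal [s], this equation and the next two say
    that [Id + s T] composed with [theta + s omega1 + s^2 omega2] is
    [theta (x + s N x) (y + s N y) (v + s T v)], one power of [s] at a time.
    The orders 1 and 2 define [omega1] and [omega2]; order 3 is the
    Nijenhuis condition. All three move [T] from outside to the arguments. *)
Lemma twist_theta x y v : T (theta x y v) =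
  theta (N x) y v + theta x (N y) v + theta x y (T v)
  - theta_omega1 N T theta x y v.
Proof. rewrite /theta_omega1; lmod_ring. Qed.

Lemma twist_omega1 x y v : T (theta_omega1 N T theta x y v) =
  theta (N x) (N y) v + theta (N x) y (T v) + theta x (N y) (T v)
  - theta_omega2 N T theta x y v.
Proof. rewrite /theta_omega2; lmod_ring. Qed.

Hypothesis compat : nijenhuis_compatible N T theta.

Lemma twist_omega2 x y v :
  T (theta_omega2 N T theta x y v) = theta (N x) (N y) (T v).
Proof.
rewrite compat /theta_omega2 /theta_omega1 !rules.
lmod_ring.
Qed.

Lemma intertwine_omega s x y v :
  let thetas :=
    theta x y v + s *: theta_omega1 N T theta x y v
                + s ^+ 2 *: theta_omega2 N T theta x y v in
  thetas + s *: T thetas = theta (x + s *: N x) (y + s *: N y) (v + s *: T v).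
Proof.
(* [omega1] and [omega2] are made opaque, as unification would otherwise
   unfold them while the linearity rules are applied. *)
have := (twist_omega2, (twist_omega1, twist_theta)).
move: (theta_omega1 N T theta) (theta_omega2 N T theta) => w1 w2 twist.
rewrite /= !(rules, twist).
lmod_ring.
Qed.

End Omega.

(** A bracket is a [theta] with values in [L = V] and [T = N], so the lemmas on
    [theta] cover it. *)
Lemma bracket_omega1E (K : fieldType) (L : lmodType K) (N : {linear L -> L})
    b x y z :
  bracket_omega1 N b x y z = theta_omega1 N N b x y z.
Proof. rewrite /bracket_omega1 /theta_omega1; lmod_ring. Qed.

Lemma bracket_omega2E (K : fieldType) (L : lmodType K) (N : {linear L -> L})
    b x y z :
  bracket_omega2 N b x y z = theta_omega2 N N b x y z.
Proof. by rewrite /bracket_omega2 /theta_omega2 bracket_omega1E. Qed.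

(** * The Leibniz identity along the pencil *)

Section IntertwinedPencil.
Variables (K : fieldType) (E : lmodType K) (N : {linear E -> E}).
Variables b w1 w2 : E -> E -> E -> E.
Hypotheses (tri_b : trilinear b) (tri_w1 : trilinear w1).
Hypothesis tri_w2 : trilinear w2.
Hypothesis leibniz_b : forall x y z t u,
  b (b x y z) t u = b x y (b z t u) + b x (b y t u) z + b (b x t u) y z.
Hypothesis N_b : forall x y z,
  N (b x y z) = b (N x) y z + b x (N y) z + b x y (N z) - w1 x y z.
Hypothesis N_w1 : forall x y z, N (w1 x y z) =
  b (N x) (N y) z + b (N x) y (N z) + b x (N y) (N z) - w2 x y z.
Hypothesis N_w2 : forall x y z, N (w2 x y z) = b (N x) (N y) (N z).

(** The Leibniz identity, polarized: the defect of [b + s w1 + s^2 w2] is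
    quadratic in the bracket, and its coefficients are sums of mixed defects,
    with [f] outside and [g] inside. *)
Definition defect (f g : E -> E -> E -> E) (x y z t u : E) : E :=
  f (g x y z) t u - f x y (g z t u) - f x (g y t u) z - f (g x t u) y z.

Lemma defect_bb x y z t u : defect b b x y z t u = 0.
Proof. rewrite /defect leibniz_b; lmod_ring. Qed.

Let rules := (trilinear_rules tri_b, trilinear_rules tri_w1,
  trilinear_rules tri_w2).
Let Nrules := (linearD N, linearN N, N_b, N_w1, N_w2).

(** Let [D_k] be the coefficient of [s^k] in the defect of
    [b + s w1 + s^2 w2]. Since [Id + s N] carries this pencil to [b], the
    coefficient [D_k + N D_(k-1)] of [s^k] in [(Id + s N) D] is the sum of the
    defects of [b] with [N] inserted in [k] of the five arguments. These vanish,
    so [D_(k-1) = 0] gives [D_k = 0]. The next four lemmas are the cases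
    [k = 1, 2, 3, 4]; in each, the rules [Nrules] push every [N] down to the
    five arguments, after which both sides agree. *)
Lemma defect1 x y z t u : defect b w1 x y z t u + defect w1 b x y z t u = 0.
Proof.
have -> : defect b w1 x y z t u + defect w1 b x y z t u =
  defect b b (N x) y z t u + defect b b x (N y) z t u +
  defect b b x y (N z) t u + defect b b x y z (N t) u +
  defect b b x y z t (N u) - N (defect b b x y z t u).
  rewrite /defect !Nrules !rules.
  lmod_ring.
by rewrite !defect_bb linear0; lmod_ring.
Qed.

Lemma defect2 x y z t u :
  defect b w2 x y z t u + defect w1 w1 x y z t u + defect w2 b x y z t u = 0.
Proof.
have -> : defect b w2 x y z t u + defect w1 w1 x y z t u + defect w2 b x y z t u =
  defect b b (N x) (N y) z t u + defect b b (N x) y (N z) t u +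
  defect b b (N x) y z (N t) u + defect b b (N x) y z t (N u) +
  defect b b x (N y) (N z) t u + defect b b x (N y) z (N t) u +
  defect b b x (N y) z t (N u) + defect b b x y (N z) (N t) u +
  defect b b x y (N z) t (N u) + defect b b x y z (N t) (N u)
  - N (defect b w1 x y z t u + defect w1 b x y z t u).
  rewrite /defect !Nrules !rules.
  lmod_ring.
by rewrite !defect_bb defect1 linear0; lmod_ring.
Qed.

Lemma defect3 x y z t u : defect w1 w2 x y z t u + defect w2 w1 x y z t u = 0.
Proof.
have -> : defect w1 w2 x y z t u + defect w2 w1 x y z t u =
  defect b b (N x) (N y) (N z) t u + defect b b (N x) (N y) z (N t) u +
  defect b b (N x) (N y) z t (N u) + defect b b (N x) y (N z) (N t) u +
  defect b b (N x) y (N z) t (N u) + defect b b (N x) y z (N t) (N u) +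
  defect b b x (N y) (N z) (N t) u + defect b b x (N y) (N z) t (N u) +
  defect b b x (N y) z (N t) (N u) + defect b b x y (N z) (N t) (N u) -
  N (defect b w2 x y z t u + defect w1 w1 x y z t u + defect w2 b x y z t u).
  rewrite /defect !Nrules !rules.
  lmod_ring.
by rewrite !defect_bb defect2 linear0; lmod_ring.
Qed.

Lemma defect4 x y z t u : defect w2 w2 x y z t u = 0.
Proof.
have -> : defect w2 w2 x y z t u =
  defect b b x (N y) (N z) (N t) (N u) + defect b b (N x) y (N z) (N t) (N u) +
  defect b b (N x) (N y) z (N t) (N u) + defect b b (N x) (N y) (N z) t (N u) +
  defect b b (N x) (N y) (N z) (N t) u -
  N (defect w1 w2 x y z t u + defect w2 w1 x y z t u).
  rewrite /defect !Nrules !rules.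
  lmod_ring.
by rewrite !defect_bb defect3 linear0; lmod_ring.
Qed.

Lemma leibniz_pencil (s : K) :
  let bs x y z := b x y z + s *: w1 x y z + s ^+ 2 *: w2 x y z in
  forall x y z t u,
  bs (bs x y z) t u = bs x y (bs z t u) + bs x (bs y t u) z + bs (bs x t u) y z.
Proof.
move=> bs x y z t u; apply: subr0_eq.
have -> : bs (bs x y z) t u -
    (bs x y (bs z t u) + bs x (bs y t u) z + bs (bs x t u) y z) =
  defect b b x y z t u +
  s *: (defect b w1 x y z t u + defect w1 b x y z t u) +
  s ^+ 2 *: (defect b w2 x y z t u + defect w1 w1 x y z t u
             + defect w2 b x y z t u) +
  s ^+ 3 *: (defect w1 w2 x y z t u + defect w2 w1 x y z t u) +
  s ^+ 4 *: defect w2 w2 x y z t u.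
  rewrite /bs /defect !rules.
  lmod_ring.
by rewrite defect_bb defect1 defect2 defect3 defect4 !scaler0; lmod_ring.
Qed.

End IntertwinedPencil.

Lemma leibniz_nijenhuis (K : fieldType) (E : lmodType K) (N : {linear E -> E})
    (b : E -> E -> E -> E) (s : K) :
  ternary_leibniz b -> nijenhuis_compatible N N b ->
  forall x y z t u,
  let bs x y z :=
    b x y z + s *: theta_omega1 N N b x y z
            + s ^+ 2 *: theta_omega2 N N b x y z in
  bs (bs x y z) t u = bs x y (bs z t u) + bs x (bs y t u) z + bs (bs x t u) y z.
Proof.
move=> [tri leib] nij x y z t u.
apply: (leibniz_pencil (N := N)) => //.
- exact: trilinear_theta_omega1.
- exact: trilinear_theta_omega2.
- exact: twist_theta.
- exact: twist_omega1.
- exact: twist_omega2.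
Qed.

(** * Semidirect products *)

Lemma eq_pair (X Y : Type) (p q : X * Y) : p.1 = q.1 -> p.2 = q.2 -> p = q.
Proof. by case: p q => [? ?] [? ?] /= -> ->. Qed.

Section Semidirect.
Variables (K : fieldType) (L V : lmodType K).
Implicit Types A : operations L V.
Local Notation E := (L * V)%type.

(** The semidirect product bracket on [L * V]: a bracket with two entries in
    [V] is zero, and [lam], [mu], [rho] give the brackets whose single entry
    in [V] stands third, second or first. *)
Definition semidirect A (p q r : E) : E :=
  (bracket A p.1 q.1 r.1,
   lam A p.1 q.1 r.2 + mu A p.1 r.1 q.2 + rho A q.1 r.1 p.2).

Lemma trilinear_semidirect A :
  trilinear (bracket A) -> trilinear (lam A) -> trilinear (mu A) ->
  trilinear (rho A) -> trilinear (semidirect A).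
Proof.
move=> /trilinear_rules b /trilinear_rules l /trilinear_rules m
  /trilinear_rules r.
by split=> [[? ?] [? ?]|[? ?] [? ?]|[? ?] [? ?]] a [? ?] [? ?];
  apply: eq_pair; rewrite /= !(b, l, m, r); lmod_ring.
Qed.

(** The [V] component of the Leibniz identity is linear in the [V] components
    of its five arguments. The five axioms of a representation are its parts
    depending on the fifth, fourth, third, second and first of them. *)
Lemma leibniz_semidirect A :
  ternary_leibniz (bracket A) -> representation A ->
  ternary_leibniz (semidirect A).
Proof.
move=> [tri_b leib] [[tri_l tri_m tri_r] repr].
split; first exact: trilinear_semidirect.
move: (trilinear_rules tri_l) (trilinear_rules tri_m) (trilinear_rules tri_r).
move=> l m r [x x'] [y y'] [z z'] [t t'] [u u'].
apply: eq_pair; first by rewrite /= leib.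
rewrite /= !(l, m, r).
have [-> _ _ _ _] := repr x y z t u'.
have [_ -> _ _ _] := repr x y z u t'.
have [_ _ -> _ _] := repr x y t u z'.
have [_ _ _ -> _] := repr x z t u y'.
have [_ _ _ _ ->] := repr y z t u x'.
lmod_ring.
Qed.

Lemma leibniz_of_semidirect A :
  multilinear_operations A -> ternary_leibniz (semidirect A) ->
  ternary_leibniz (bracket A) /\ representation A.
Proof.
move=> [tri_b tri_l tri_m tri_r] [_ leib].
have zeros := (trilinear_rules tri_l, trilinear_rules tri_m,
  trilinear_rules tri_r).
split; split=> // x y z t.
  by move=> u; have /(congr1 fst) := leib (x, 0) (y, 0) (z, 0) (t, 0) (u, 0).
move=> v; split.
- have /(congr1 snd) := leib (x, 0) (y, 0) (z, 0) (t, 0) (0, v).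
  by rewrite /= !zeros ?(addr0, add0r).
- have /(congr1 snd) := leib (x, 0) (y, 0) (z, 0) (0, v) (t, 0).
  by rewrite /= !zeros ?(addr0, add0r).
- have /(congr1 snd) := leib (x, 0) (y, 0) (0, v) (z, 0) (t, 0).
  by rewrite /= !zeros ?(addr0, add0r).
- have /(congr1 snd) := leib (x, 0) (0, v) (y, 0) (z, 0) (t, 0).
  by rewrite /= !zeros ?(addr0, add0r).
- have /(congr1 snd) := leib (0, v) (x, 0) (y, 0) (z, 0) (t, 0).
  by rewrite /= !zeros ?(addr0, add0r).
Qed.

Variables (N : {linear L -> L}) (T : {linear V -> V}).

Definition pair_map (p : E) : E := (N p.1, T p.2).

Fact pair_map_linear : linear pair_map.
Proof. by move=> a p q; apply: eq_pair; rewrite /= linearP. Qed.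

HB.instance Definition _ :=
  GRing.isLinear.Build K E E *:%R pair_map pair_map_linear.

(** The cochains for [A] and [(N, T)] are together those of the bracket
    [semidirect A] and the single operator [pair_map]. *)
Lemma semidirect_omega1 A p q r :
  semidirect (nijenhuis_omega1 A N T) p q r =
  theta_omega1 pair_map pair_map (semidirect A) p q r.
Proof.
apply: eq_pair; rewrite /= /bracket_omega1 /theta_omega1.
  lmod_ring.
rewrite !linearD.
lmod_ring.
Qed.

Lemma semidirect_omega2 A p q r :
  semidirect (nijenhuis_omega2 A N T) p q r =
  theta_omega2 pair_map pair_map (semidirect A) p q r.
Proof.
rewrite /theta_omega2 -semidirect_omega1.
apply: eq_pair; rewrite /= /bracket_omega2 /theta_omega2.
  lmod_ring.
rewrite !linearD.
lmod_ring.
Qed.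

Lemma semidirect_nijenhuis A :
  nijenhuis_pair A N T ->
  nijenhuis_compatible pair_map pair_map (semidirect A).
Proof.
move=> [nij_b [nij_l nij_m nij_r]] p q r.
apply: eq_pair; rewrite /= ?nij_b ?nij_l ?nij_m ?nij_r.
  rewrite !linearD; lmod_ring.
rewrite !(linearD, linearN); lmod_ring.
Qed.

Lemma semidirect_deformed A W1 W2 s p q r :
  semidirect (deformed A W1 W2 s) p q r =
  semidirect A p q r + s *: semidirect W1 p q r + s ^+ 2 *: semidirect W2 p q r.
Proof. apply: eq_pair => //=; lmod_ring. Qed.

End Semidirect.

(** * Deformation by a Nijenhuis pair *)

Theorem theorem4p4 (K : fieldType) (L V : lmodType K) (A : operations L V)
    (N : {linear L -> L}) (T : {linear V -> V})
    (leibnizA : ternary_leibniz (bracket A))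
    (reprA : representation A)
    (nijNT : nijenhuis_pair A N T) :
  let W1 := nijenhuis_omega1 A N T in
  let W2 := nijenhuis_omega2 A N T in
  infinitesimal_deformation A W1 W2 /\ trivial_deformation A W1 W2.
Proof.
move=> W1 W2.
have [[tri_b _] [[tri_l tri_m tri_r] _]] := (leibnizA, reprA).
have multi1 : multilinear_operations W1.
  split; try exact: trilinear_theta_omega1.
  apply: eq_trilinear (trilinear_theta_omega1 N N tri_b) => x y z.
  by rewrite -bracket_omega1E.
have multi2 : multilinear_operations W2.
  split; try exact: trilinear_theta_omega2.
  apply: eq_trilinear (trilinear_theta_omega2 N N tri_b) => x y z.
  by rewrite -bracket_omega2E.
split.
  split=> // s.
  have multi_s : multilinear_operations (deformed A W1 W2 s).
    case: multi1 multi2 => [? ? ? ?] [? ? ? ?].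
    by split; apply: trilinear_pencil.
  (* Leibniz algebra and representation at once, on [L * V]. *)
  apply: leibniz_of_semidirect => //; split.
    by case: multi_s; apply: trilinear_semidirect.
  move=> p q r t u.
  rewrite !semidirect_deformed !semidirect_omega1 !semidirect_omega2.
  apply: leibniz_nijenhuis; first exact: leibniz_semidirect.
  exact: semidirect_nijenhuis.
have [nij_b [nij_l nij_m nij_r]] := nijNT.
exists N, T => s; split=> x y z; try exact: intertwine_omega.
rewrite /= bracket_omega1E bracket_omega2E.
apply: intertwine_omega => // {}x {}y {}z; rewrite nij_b.
(* The two Nijenhuis conditions list their summands in different orders. *)
congr (N _ - N (N _) + _); lmod_ring.
Qed.
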